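(* Let $n\ge 2$ and let $D\subsetneq\mathbb{R}^n$ be a proper subdomain. Then the expression $$i_D^*(x,y)=2\log\frac{\eta_D(x)+\eta_D(y)+d(D)\,|x-y|}{2\sqrt{\eta_D(x)\,\eta_D(y)}},\qquad x,y\in D,$$ defines a metric on $D$.
   Context: A domain is a nonempty open connected set. For a proper subdomain $D\subset\mathbb{R}^n$ and $z\in D$, $\delta_D(z)=\inf\{|z-\xi|:\xi\in\partial D\}$ is the Euclidean distance from $z$ to $\partial D$, $d(D)$ is the Euclidean diameter of $D$ (infinite if $D$ is unbounded), and, when $D$ is bounded, $\eta_D(z)=\delta_D(z)\,(d(D)-\delta_D(z))$. If $D$ is unbounded, the expression is read with $\eta_D(z)/d(D)$ replaced by $\delta_D(z)$, that is, $i_D^*(x,y)=2\log\frac{\delta_D(x)+\delta_D(y)+|x-y|}{2\sqrt{\delta_D(x)\delta_D(y)}}$. *)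

(* Defs.v *)
From mathcomp Require Import all_boot all_order all_algebra.
From mathcomp Require Import all_classical all_reals all_analysis.

Set Implicit Arguments.
Unset Strict Implicit.
Unset Printing Implicit Defensive.

Import Order.TTheory GRing.Theory Num.Theory.
Import numFieldNormedType.Exports.

Local Open Scope classical_set_scope.
Local Open Scope ring_scope.

(* The library norm on ['rV[R]_n] is the sup norm; it induces the usual
   topology of R^n but not the Euclidean distance, hence this definition. *)
Definition eucl_dist (R : realType) (n : nat) (x y : 'rV[R]_n) : R :=
  Num.sqrt (\sum_(i < n) (x ord0 i - y ord0 i) ^+ 2).

Definition domain (R : realType) (n : nat) (D : set 'rV[R]_n) : Prop :=
  [/\ D !=set0, open D & connected D].

Definition boundary (T : topologicalType) (A : set T) : set T :=
  closure A `\` interior A.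

Definition bdist (R : realType) (n : nat) (D : set 'rV[R]_n) (z : 'rV[R]_n) : R :=
  inf [set eucl_dist z xi | xi in boundary D].

(* Extended-real valued: for nonempty [D] it is [+oo] iff [D] is unbounded. *)
Definition diam (R : realType) (n : nat) (D : set 'rV[R]_n) : \bar R :=
  ereal_sup [set e | exists x y, [/\ D x, D y & e = (eucl_dist x y)%:E]].

(* Only meaningful for bounded [D], since [fine +oo = 0]. *)
Definition eta (R : realType) (n : nat) (D : set 'rV[R]_n) (z : 'rV[R]_n) : R :=
  bdist D z * (fine (diam D) - bdist D z).

Definition istar (R : realType) (n : nat) (D : set 'rV[R]_n)
    (x y : 'rV[R]_n) : R :=
  if diam D == +oo%E then
    2 * ln ((bdist D x + bdist D y + eucl_dist x y)
            / (2 * Num.sqrt (bdist D x * bdist D y)))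
  else
    2 * ln ((eta D x + eta D y + fine (diam D) * eucl_dist x y)
            / (2 * Num.sqrt (eta D x * eta D y))).

Definition metric_on (R : realType) (T : Type) (D : set T) (d : T -> T -> R) :
    Prop :=
  [/\ forall x y, D x -> D y -> 0 <= d x y,
      forall x y, D x -> D y -> (d x y = 0 <-> x = y),
      forall x y, D x -> D y -> d x y = d y x
    & forall x y z, D x -> D y -> D z -> d x z <= d x y + d y z].

(* Main.v *)
Require Import Defs.
From mathcomp Require Import all_boot all_order all_algebra.
From mathcomp Require Import all_classical all_reals all_analysis.
From mathcomp Require Import ring lra.

Set Implicit Arguments.
Unset Strict Implicit.
Unset Printing Implicit Defensive.

Import Order.TTheory GRing.Theory Num.Theory.
Import numFieldNormedType.Exports.

Local Open Scope ring_scope.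
Local Open Scope classical_set_scope.

(** The two formulas for [istar] are instances of one construction: from a
    metric [rho] and a positive weight [w] that is 1-Lipschitz for [rho], form
    [2 ln ((w x + w y + rho x y) / (2 sqrt (w x w y)))]. This is always a metric
    ([ln_metric]); the triangle inequality comes down to the nonnegativity of
    the product of [w x - w y + rho x y] and [w z - w y + rho y z].

    For unbounded [D], take for [rho] the Euclidean distance and for [w] the
    distance [delta] to the boundary, which is positive because [D] is open and
    1-Lipschitz as an infimum of 1-Lipschitz functions. For bounded [D] of
    diameter [d], take [rho = d |x - y|] and [w = delta (d - delta)]. The points
    to check are that [delta < d] ([bdist_lt_diam]), which makes [w] positive,
    and that [w x - w y = (delta x - delta y) (d - delta x - delta y)], whose
    second factor lies in [[-d, d]] ([eta_lipschitz]). Both cases need the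
    boundary to be nonempty, which is where connectedness of the whole space
    enters ([boundary_neq0]). *)

(** * The Euclidean distance *)

(** The vector [B a - C b] is [B] times the component of [a] orthogonal to [b],
    and its squared length is [B (A B - C^2)]; this is nonnegative. *)
Lemma cauchy_schwarz_sum (R : realType) (I : finType) (a b : I -> R) :
  (\sum_i a i * b i) ^+ 2 <= (\sum_i a i ^+ 2) * (\sum_i b i ^+ 2).
Proof.
set A := \sum_i a i ^+ 2; set B := \sum_i b i ^+ 2; set C := \sum_i a i * b i.
have B0 : 0 <= B by apply: sumr_ge0 => i _; exact: sqr_ge0.
have [Bz|Bnz] := eqVneq B 0.
  have b0 i : b i = 0.
    have /eqP := Bz; rewrite psumr_eq0 => [/allP/(_ i)|j _]; last exact: sqr_ge0.
    by rewrite mem_index_enum => /(_ isT)/=; rewrite sqrf_eq0 => /eqP.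
  rewrite Bz mulr0 /C big1 ?expr0n// => i _; by rewrite b0 mulr0.
have Bgt : 0 < B by rewrite lt_neqAle eq_sym Bnz.
have E : \sum_i (B * a i - C * b i) ^+ 2 = B * (A * B - C ^+ 2).
  transitivity (\sum_i (B ^+ 2 * a i ^+ 2 - (B * C *+ 2) * (a i * b i)
                         + C ^+ 2 * b i ^+ 2)).
    by apply: eq_bigr => i _; ring.
  rewrite big_split /= sumrB -!mulr_sumr -/A -/B -/C; ring.
have : 0 <= B * (A * B - C ^+ 2).
  by rewrite -E; apply: sumr_ge0 => i _; exact: sqr_ge0.
by rewrite pmulr_rge0// subr_ge0.
Qed.

Lemma minkowski_sum (R : realType) (I : finType) (a b : I -> R) :
  Num.sqrt (\sum_i (a i + b i) ^+ 2)
    <= Num.sqrt (\sum_i a i ^+ 2) + Num.sqrt (\sum_i b i ^+ 2).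
Proof.
have A0 : 0 <= \sum_i a i ^+ 2 by apply: sumr_ge0 => i _; exact: sqr_ge0.
have B0 : 0 <= \sum_i b i ^+ 2 by apply: sumr_ge0 => i _; exact: sqr_ge0.
have C_le : \sum_i a i * b i
    <= Num.sqrt (\sum_i a i ^+ 2) * Num.sqrt (\sum_i b i ^+ 2).
  rewrite -sqrtrM//; apply: le_trans (ler_norm _) _.
  by rewrite -sqrtr_sqr ler_wsqrtr// cauchy_schwarz_sum.
rewrite -[leRHS]ger0_norm ?addr_ge0 ?sqrtr_ge0// -sqrtr_sqr ler_wsqrtr//.
rewrite sqrrD !sqr_sqrtr//.
under eq_bigr do rewrite sqrrD.
rewrite !big_split /=; lra.
Qed.

Lemma eucl_dist_ge0 (R : realType) n (x y : 'rV[R]_n) : 0 <= eucl_dist x y.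
Proof. exact: sqrtr_ge0. Qed.

Lemma eucl_distC (R : realType) n (x y : 'rV[R]_n) :
  eucl_dist x y = eucl_dist y x.
Proof.
by congr Num.sqrt; apply: eq_bigr => i _; rewrite -sqrrN opprB.
Qed.

Lemma eucl_dist_triangle (R : realType) n (y x z : 'rV[R]_n) :
  eucl_dist x z <= eucl_dist x y + eucl_dist y z.
Proof.
apply: le_trans (minkowski_sum _ _); rewrite ler_wsqrtr//.
by apply: ler_sum => i _; rewrite addrA subrK.
Qed.

Lemma coord_le_eucl_dist (R : realType) n (x y : 'rV[R]_n) (i : 'I_n) :
  `|x ord0 i - y ord0 i| <= eucl_dist x y.
Proof.
rewrite -sqrtr_sqr ler_wsqrtr// (bigD1 i)//= lerDl.
by apply: sumr_ge0 => j _; exact: sqr_ge0.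
Qed.

Lemma eucl_dist_eq0 (R : realType) n (x y : 'rV[R]_n) :
  eucl_dist x y = 0 <-> x = y.
Proof.
split=> [d0|->]; last first.
  by rewrite /eucl_dist big1 ?sqrtr0// => i _; rewrite subrr expr0n.
apply/rowP => i; apply/eqP; rewrite -subr_eq0 -normr_le0 -d0.
exact: coord_le_eucl_dist.
Qed.

Lemma eucl_dist_ray (R : realType) n (xi x : 'rV[R]_n) (e : R) : 0 <= e ->
  eucl_dist xi (x + e *: (x - xi)) = (1 + e) * eucl_dist xi x.
Proof.
move=> e0; have e1 : 0 <= 1 + e by lra.
rewrite -[in RHS](ger0_norm e1) -sqrtr_sqr -sqrtrM ?sqr_ge0// mulr_sumr.
by congr Num.sqrt; apply: eq_bigr => i _; rewrite !mxE; ring.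
Qed.

Lemma eucl_dist_metric (R : realType) n (D : set 'rV[R]_n) :
  metric_on D (@eucl_dist R n).
Proof.
split=> [x y _ _|x y _ _|x y _ _|x y z _ _ _].
- exact: eucl_dist_ge0.
- exact: eucl_dist_eq0.
- exact: eucl_distC.
- exact: eucl_dist_triangle.
Qed.

(** * Logarithmic metrics built from a Lipschitz weight *)

Lemma metric_on_scale (R : realType) (T : Type) (D : set T) (d : T -> T -> R)
    (k : R) : 0 < k -> metric_on D d -> metric_on D (fun x y => k * d x y).
Proof.
move=> k0 [d0 dE dC dT]; split=> [x y Dx Dy|x y Dx Dy|x y Dx Dy|x y z Dx Dy Dz].
- by rewrite mulr_ge0 ?d0// ltW.
- rewrite -(dE x y)//; split=> [/eqP|->]; last by rewrite mulr0.
  by rewrite mulf_eq0 gt_eqF//= => /eqP.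
- by rewrite dC.
- by rewrite -mulrDr ler_wpM2l ?dT// ltW.
Qed.

(** For the triangle inequality, exponentiate and clear the common factor
    [sqrt (w x * w z)]. With [P = w x + w y + rho x y] and
    [Q = w y + w z + rho y z], the triangle inequality for [rho] leaves
    [2 w y (P + Q - 2 w y) <= P Q], that is
    [0 <= (P - 2 w y) (Q - 2 w y)], and both factors are nonnegative because
    [w] is 1-Lipschitz. Separation comes from the arithmetic-geometric mean
    inequality: the quotient is at least 1, with equality only if
    [rho x y = 0]. *)
Lemma ln_metric (R : realType) (T : Type) (D : set T) (rho : T -> T -> R)
    (w : T -> R) :
  metric_on D rho ->
  (forall x, D x -> 0 < w x) ->
  (forall x y, D x -> D y -> w x - w y <= rho x y) ->
  metric_on D (fun x y =>
    2 * ln ((w x + w y + rho x y) / (2 * Num.sqrt (w x * w y)))).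
Proof.
move=> [r0 rE rC rT] w0 wL.
pose q x y := (w x + w y + rho x y) / (2 * Num.sqrt (w x * w y)).
have s0 x y : D x -> D y -> 0 < 2 * Num.sqrt (w x * w y).
  by move=> Dx Dy; rewrite mulr_gt0// sqrtr_gt0 mulr_gt0 ?w0.
have amgm x y : D x -> D y -> w x + w y - 2 * Num.sqrt (w x * w y)
                              = (Num.sqrt (w x) - Num.sqrt (w y)) ^+ 2.
  move=> Dx Dy; rewrite sqrrB !sqr_sqrtr ?ltW ?w0// sqrtrM ?ltW ?w0//; ring.
have q1 x y : D x -> D y -> 1 <= q x y.
  move=> Dx Dy; rewrite ler_pdivlMr ?s0// mul1r.
  have := sqr_ge0 (Num.sqrt (w x) - Num.sqrt (w y)).
  by rewrite -amgm//; have := r0 x y Dx Dy; lra.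
have qpos x y : D x -> D y -> 0 < q x y.
  by move=> Dx Dy; apply: lt_le_trans (q1 x y Dx Dy).
split=> [x y Dx Dy|x y Dx Dy|x y Dx Dy|x y z Dx Dy Dz].
- by rewrite mulr_ge0// ln_ge0// q1.
- split=> [/eqP|<-].
    rewrite mulf_eq0 pnatr_eq0/= ln_eq0; last exact: qpos.
    move=> /eqP /divr1_eq qE.
    apply/(rE x y Dx Dy)/eqP; rewrite eq_le r0// andbT.
    have := sqr_ge0 (Num.sqrt (w x) - Num.sqrt (w y)).
    by rewrite -amgm//; lra.
  have -> : rho x x = 0 by exact/rE.
  rewrite -expr2 sqrtr_sqr gtr0_norm ?w0// addr0.
  have -> : w x + w x = 2 * w x by ring.
  by rewrite divff ?ln1 ?mulr0// gt_eqF// mulr_gt0 ?w0.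
- by rewrite [rho x y]rC// [w x + w y]addrC [w x * w y]mulrC.
rewrite -mulrDr ler_wpM2l// -lnM ?posrE ?qpos//.
rewrite ler_ln ?posrE; [|exact: qpos|by apply: mulr_gt0; exact: qpos].
have wx := w0 _ Dx; have wy := w0 _ Dy; have wz := w0 _ Dz.
have -> : (w x + w y + rho x y) / (2 * Num.sqrt (w x * w y))
      * ((w y + w z + rho y z) / (2 * Num.sqrt (w y * w z)))
    = (w x + w y + rho x y) * (w y + w z + rho y z) / (2 * w y)
      / (2 * Num.sqrt (w x * w z)).
  rewrite !sqrtrM ?ltW//.
  have -> : 2 * w y = 2 * Num.sqrt (w y) ^+ 2 by rewrite sqr_sqrtr ?ltW.
  field.
  by rewrite !gt_eqF ?sqrtr_gt0.
rewrite ler_pM2r ?invr_gt0 ?s0// ler_pdivlMr ?mulr_gt0//.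
have h1 := wL y x Dy Dx; have h2 := wL y z Dy Dz; have h3 := rT x y z Dx Dy Dz.
rewrite rC// in h1.
have h4 : 0 <= (w x + rho x y - w y) * (w z + rho y z - w y).
  by rewrite mulr_ge0//; lra.
have h5 : (rho x y + rho y z - rho x z) * w y >= 0.
  by rewrite mulr_ge0 ?subr_ge0// ltW.
nra.
Qed.

(** * Topology of the coordinate space *)

Lemma connected_rV (R : realType) n : connected [set: 'rV[R]_n].
Proof.
(* The space is the union of the lines through the origin. *)
have -> : [set: 'rV[R]_n]
    = \bigcup_(q in [set: 'rV[R]_n]) range (fun t : R => t *: q).
  by apply/seteqP; split=> // q _; exists q => //; exists 1; rewrite ?scale1r.
apply: bigcup_connected; first by exists 0 => q _; exists 0; rewrite ?scale0r.
move=> q _; apply: connected_continuous_connected.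
  by apply/connected_intervalP => x y.
by apply: continuous_subspaceT => t; apply: scalel_continuous.
Qed.

Lemma eucl_dist_continuous (R : realType) n (x : 'rV[R]_n) :
  continuous (eucl_dist x).
Proof.
have sum_cont : continuous
    (fun y : 'rV[R]_n => \sum_(i < n) (x ord0 i - y ord0 i) ^+ 2).
  apply: continuous_big => [|i _ y]; first exact: add_continuous.
  have coord_cont : (fun z : 'rV[R]_n => x ord0 i - z ord0 i)
      @ y --> x ord0 i - y ord0 i.
    exact: (cvgB (cvg_cst (x ord0 i)) (@coord_continuous R _ _ ord0 i y)).
  exact: (cvgM coord_cont coord_cont).
move=> y; apply: (@continuous_comp _ _ _ _ Num.sqrt y (sum_cont y)).
exact: sqrt_continuous.
Qed.

(** Carries the bound [diam D] on distances over to boundary points. *)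
Lemma closure_eucl_dist_le (R : realType) n (D : set 'rV[R]_n) (x : 'rV[R]_n)
    (c : R) :
  (forall y, D y -> eucl_dist x y <= c) ->
  forall y, closure D y -> eucl_dist x y <= c.
Proof.
move=> Dc; have closed_ball : closed [set y | eucl_dist x y <= c].
  apply: (@preimage_closed _ _ (eucl_dist x) [set t | t <= c]).
    by move=> t _; exact: eucl_dist_continuous.
  exact: closed_le.
by rewrite closureE; exact: (smallest_sub closed_ball Dc).
Qed.

(** A set with empty boundary is closed and open, hence trivial by
    connectedness of the space. Without boundary points the infimum defining
    [bdist] would be the junk value 0. *)
Lemma boundary_neq0 (R : realType) n (D : set 'rV[R]_n) :
  D !=set0 -> open D -> D <> setT -> boundary D !=set0.
Proof.
move=> D0 oD DT; apply: contrapT => /set0P/negP/negPn/eqP bD0; apply: DT.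
apply: (@connected_rV R n D D0); exists D; rewrite ?setTI//.
apply/closure_id/seteqP; split; first exact: subset_closure.
move=> x cx; apply: contrapT => nDx; rewrite -[False]/(set0 x) -bD0.
by split=> // /interior_subset.
Qed.

(** * Distance to the boundary *)

Lemma bdist_le (R : realType) n (D : set 'rV[R]_n) z xi :
  boundary D xi -> bdist D z <= eucl_dist z xi.
Proof.
move=> bxi; apply: ge_inf; last by exists xi.
by exists 0 => _ [y _ <-]; exact: eucl_dist_ge0.
Qed.

Lemma bdist_ge (R : realType) n (D : set 'rV[R]_n) z c :
  boundary D !=set0 -> (forall xi, boundary D xi -> c <= eucl_dist z xi) ->
  c <= bdist D z.
Proof.
move=> bD0 cP; apply: lb_le_inf; last by move=> _ [xi bxi <-]; exact: cP.
by case: bD0 => xi bxi; exists (eucl_dist z xi), xi.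
Qed.

Lemma bdist_lipschitz (R : realType) n (D : set 'rV[R]_n) x y :
  boundary D !=set0 -> bdist D x - bdist D y <= eucl_dist x y.
Proof.
move=> bD0; rewrite lerBlDr -lerBlDl; apply: bdist_ge => // xi bxi.
rewrite lerBlDl; exact: le_trans (bdist_le x bxi) (eucl_dist_triangle _ _ _).
Qed.

Lemma bdist_gt0 (R : realType) n (D : set 'rV[R]_n) x :
  boundary D !=set0 -> open D -> D x -> 0 < bdist D x.
Proof.
move=> bD0 oD Dx.
have /nbhs_ballP[r /= r0 rD] : nbhs x D by exact: open_nbhs_nbhs.
apply: (lt_le_trans r0); apply: bdist_ge => // xi [_]; rewrite (interior_id _).1//.
move=> nDxi; rewrite leNgt; apply/negP => xr; apply: nDxi; apply: rD.
split=> // i j; rewrite (ord1 i).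
(* The balls of the topology are those of the sup norm, which is at most the
   Euclidean one. *)
exact: le_lt_trans (coord_le_eucl_dist x xi j) xr.
Qed.

Lemma eucl_dist_le_diam (R : realType) n (D : set 'rV[R]_n) x xi :
  diam D != +oo%E -> D x -> closure D xi -> eucl_dist x xi <= fine (diam D).
Proof.
move=> dD Dx; apply: closure_eucl_dist_le => y Dy.
have le_diam a b : D a -> D b -> ((eucl_dist a b)%:E <= diam D)%E.
  by move=> Da Db; apply: ereal_sup_ubound; exists a, b.
rewrite -lee_fin fineK ?le_diam// ge0_fin_numE ?ltey//.
by apply: le_trans (le_diam _ _ Dx Dx); rewrite lee_fin eucl_dist_ge0.
Qed.

(** Take a boundary point [xi]. As [D] is open, [x] can be moved slightly away
    from [xi] inside [D]; the moved point is strictly farther from [xi] than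
    [x], and its distance to [xi] is still at most the diameter. *)
Lemma bdist_lt_diam (R : realType) n (D : set 'rV[R]_n) x :
  boundary D !=set0 -> open D -> diam D != +oo%E -> D x ->
  bdist D x < fine (diam D).
Proof.
move=> bD0 oD dD Dx; have [xi bxi] := bD0.
have /nbhs_ballP[r /= r0 rD] : \forall t \near (0 : R), D (x + t *: (x - xi)).
  have : {for 0, continuous (fun t : R => x + t *: (x - xi))}.
    by apply: cvgD; [exact: cvg_cst|exact: scalel_continuous].
  by apply; rewrite /= scale0r addr0; exact: open_nbhs_nbhs.
have e0 : 0 < r / 2 by rewrite divr_gt0.
have /rD/(eucl_dist_le_diam dD)/(_ bxi.1) : ball 0 r (r / 2).
  by rewrite -ball_normE /= sub0r normrN gtr0_norm//; lra.
rewrite eucl_distC (eucl_dist_ray _ _ (ltW e0)) eucl_distC => le_d.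
have := bdist_le x bxi; have := bdist_gt0 bD0 oD Dx; nra.
Qed.

Lemma eta_gt0 (R : realType) n (D : set 'rV[R]_n) x :
  boundary D !=set0 -> open D -> diam D != +oo%E -> D x -> 0 < eta D x.
Proof.
by move=> bD0 oD dD Dx; rewrite mulr_gt0 ?bdist_gt0// subr_gt0 bdist_lt_diam.
Qed.

(** The difference of the two values factors as
    [(delta x - delta y) (d - delta x - delta y)]. *)
Lemma eta_lipschitz (R : realType) n (D : set 'rV[R]_n) x y :
  boundary D !=set0 -> open D -> diam D != +oo%E -> D x -> D y ->
  eta D x - eta D y <= fine (diam D) * eucl_dist x y.
Proof.
move=> bD0 oD dD Dx Dy; rewrite /eta.
have hx := bdist_lt_diam bD0 oD dD Dx; have hy := bdist_lt_diam bD0 oD dD Dy.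
have px := bdist_gt0 bD0 oD Dx; have py := bdist_gt0 bD0 oD Dy.
have lxy := bdist_lipschitz x y bD0; have := bdist_lipschitz y x bD0.
rewrite eucl_distC => lyx.
move: (bdist D x) (bdist D y) (fine (diam D)) hx hy px py lxy lyx.
move=> u v d hx hy px py lxy lyx.
have -> : u * (d - u) - v * (d - v) = (u - v) * (d - u - v) by ring.
(* Both [u] and [v] lie between 0 and [d], so [|d - u - v| <= d]. *)
apply: le_trans (ler_norm _) _; rewrite normrM mulrC.
by apply: ler_pM => //; rewrite ler_norml; lra.
Qed.

Theorem proposition3p3 (R : realType) (n : nat) (D : set 'rV[R]_n) :
  (2 <= n)%N -> domain D -> D <> setT -> metric_on D (istar D).
Proof.
move=> _ [D0 oD _] DT; have bD0 := boundary_neq0 D0 oD DT.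
rewrite /istar; have [_|dD] := eqVneq (diam D) +oo%E.
  apply: ln_metric; first exact: eucl_dist_metric.
    by move=> x; exact: bdist_gt0.
  by move=> x y _ _; exact: bdist_lipschitz.
apply: (@ln_metric _ _ _ (fun x y => fine (diam D) * eucl_dist x y)).
- apply: metric_on_scale; last exact: eucl_dist_metric.
  have [x Dx] := D0.
  exact: lt_trans (bdist_gt0 bD0 oD Dx) (bdist_lt_diam bD0 oD dD Dx).
- by move=> x; exact: eta_gt0.
- by move=> x y; exact: eta_lipschitz.
Qed.
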